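(* Let $d\in\mathbb N$ and let $\mathcal K$ be a Fraïssé class. The following are equivalent: (1) the universal minimal flow $M(G_\mathcal K)$ has at most $d$ points; (2) the Ramsey degree for embeddings of $\mathcal K$ is at most $d$.
   Context: Structures are over a countable first-order language $L$. For structures $A,B$, $B^A$ denotes the set of embeddings of $A$ into $B$, and $A\le B$ means $B^A\neq\emptyset$. A class $\mathcal K$ of finite $L$-structures is a Fraïssé class if it is hereditary, has the joint embedding property, has amalgamation (for $A,B_0,B_1\in\mathcal K$ and $a_i\in B_i^A$ there are $C\in\mathcal K$, $b_i\in C^{B_i}$ with $b_0\circ a_0=b_1\circ a_1$), and contains structures of every finite size $\ge n$ for each $n$. Its Fraïssé limit $\mathrm{Flim}(\mathcal K)$ is the unique (up to isomorphism) countably infinite, locally finite, ultrahomogeneous structure whose age (class of finitely generated structures embeddable in it) is $\mathcal K$. $G_\mathcal K:=\mathrm{Aut}(\mathrm{Flim}(\mathcal K))$ with the pointwise convergence topology (basic identity neighbourhoods: pointwise stabilizers of finite substructures). A $G$-flow is a continuous action of a topological group $G$ on a compact Hausdorff space; $M(G)$ is the universal minimal $G$-flow (minimal flow mapping homomorphically onto every minimal $G$-flow). Write $[k]=\{0,\dots,k-1\}$. For structures $A,B,C$ and $k,d\in\mathbb N$, $C\hookrightarrow(B)^A_{k,d}$ means: for every $\chi:C^A\to[k]$ there is $b\in C^B$ with $|\chi(\{b\circ a: a\in B^A\})|\le d$. The Ramsey degree for embeddings of $A\in\mathcal K$ in $\mathcal K$ is the least $d\in\mathbb N$ such that for all $B\in\mathcal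 K$ and $k\ge 2$ there is $C\in\mathcal K$ with $C\hookrightarrow(B)^A_{k,d}$ (and $\infty$ if no such $d$ exists); the Ramsey degree for embeddings of $\mathcal K$ is the supremum of these over $A\in\mathcal K$. *)

(* Defs.v *)
From Stdlib Require Import List Arith.
From Stdlib Require Vectors.Fin.
Import ListNotations.
Set Implicit Arguments.

(* A countable first-order language: function symbols (constants are
   0-ary function symbols) and relation symbols, each with an arity. *)
Record language := {
  fsym : Type;
  rsym : Type;
  farity : fsym -> nat;
  rarity : rsym -> nat;
  fsym_countable : exists c : fsym -> nat, forall f g, c f = c g -> f = g;
  rsym_countable : exists c : rsym -> nat, forall r s, c r = c s -> r = s
}.

Record structure (L : language) := {
  carrier :> Type;
  finterp : forall f : fsym L, (Fin.t (farity L f) -> carrier) -> carrier;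
  rinterp : forall r : rsym L, (Fin.t (rarity L r) -> carrier) -> Prop
}.

Section Structures.
Variable L : language.

Definition embedding (A B : structure L) (e : A -> B) : Prop :=
  (forall x y, e x = e y -> x = y) /\
  (forall f (xs : Fin.t (farity L f) -> A),
      e (finterp A f xs) = finterp B f (fun i => e (xs i))) /\
  (forall r (xs : Fin.t (rarity L r) -> A),
      rinterp A r xs <-> rinterp B r (fun i => e (xs i))).

Definition embeds (A B : structure L) : Prop := exists e : A -> B, embedding A B e.

Definition finite_struct (A : structure L) : Prop :=
  exists l : list A, forall x, In x l.

Definition size_ge (A : structure L) (n : nat) : Prop :=
  exists l : list A, NoDup l /\ n <= length l.

Definition fclosed (A : structure L) (P : A -> Prop) : Prop :=
  forall f (xs : Fin.t (farity L f) -> A), (forall i, P (xs i)) -> P (finterp A f xs).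

Definition generated (A : structure L) (s : list A) (x : A) : Prop :=
  forall P : A -> Prop, fclosed A P -> (forall y, In y s -> P y) -> P x.

Definition finitely_generated (A : structure L) : Prop :=
  exists s : list A, forall x, generated A s x.

Definition locally_finite (A : structure L) : Prop :=
  forall s : list A, exists t : list A, forall x, generated A s x -> In x t.

Definition countably_infinite (A : structure L) : Prop :=
  exists h : nat -> A,
    (forall m n, h m = h n -> m = n) /\ (forall x, exists n, h n = x).

Definition automorphism (F : structure L) (g : F -> F) : Prop :=
  embedding F F g /\ (forall y, exists x, g x = y).

(* ultrahomogeneity: every isomorphism between finitely generated
   substructures extends to an automorphism (stated with embeddings) *)
Definition ultrahomogeneous (F : structure L) : Prop :=
  forall (A : structure L) (e1 e2 : A -> F),
    finitely_generated A -> embedding A F e1 -> embedding A F e2 ->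
    exists g, automorphism F g /\ forall x, g (e1 x) = e2 x.

Definition hereditary (K : structure L -> Prop) : Prop :=
  forall A B, K B -> embeds A B -> K A.

Definition joint_embedding (K : structure L -> Prop) : Prop :=
  forall A B, K A -> K B -> exists C, K C /\ embeds A C /\ embeds B C.

Definition amalgamation (K : structure L -> Prop) : Prop :=
  forall (A B0 B1 : structure L) (a0 : A -> B0) (a1 : A -> B1),
    K A -> K B0 -> K B1 -> embedding A B0 a0 -> embedding A B1 a1 ->
    exists (C : structure L) (b0 : B0 -> C) (b1 : B1 -> C),
      K C /\ embedding B0 C b0 /\ embedding B1 C b1 /\
      forall x, b0 (a0 x) = b1 (a1 x).

Definition fraisse_class (K : structure L -> Prop) : Prop :=
  (forall A, K A -> finite_struct A) /\
  hereditary K /\ joint_embedding K /\ amalgamation K /\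
  (forall n, exists A, K A /\ size_ge A n).

Definition is_fraisse_limit (K : structure L -> Prop) (F : structure L) : Prop :=
  countably_infinite F /\ locally_finite F /\ ultrahomogeneous F /\
  (forall A : structure L, (finitely_generated A /\ embeds A F) <-> K A).

Record topology (X : Type) := {
  is_open : (X -> Prop) -> Prop;
  open_full : is_open (fun _ => True);
  open_inter : forall U V, is_open U -> is_open V -> is_open (fun x => U x /\ V x);
  open_union : forall (I : Type) (U : I -> X -> Prop),
      (forall i, is_open (U i)) -> is_open (fun x => exists i, U i x)
}.

Definition compact (X : Type) (T : topology X) : Prop :=
  forall (I : Type) (U : I -> X -> Prop),
    (forall i, is_open T (U i)) -> (forall x, exists i, U i x) ->
    exists l : list I, forall x, exists i, In i l /\ U i x.

Definition hausdorff (X : Type) (T : topology X) : Prop :=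
  forall x y : X, x <> y -> exists U V, is_open T U /\ is_open T V /\
    U x /\ V y /\ forall z, ~ (U z /\ V z).

(* A G-flow for G = Aut(F) with the pointwise convergence topology.
   Group elements are the automorphisms g : F -> F; composition is the
   group law. The neighbourhoods of g are { h | h agrees with g on s },
   s a finite subset of F. *)
Record Gflow (F : structure L) (X : Type) := {
  ftop : topology X;
  fcompact : compact ftop;
  fhausdorff : hausdorff ftop;
  act : (F -> F) -> X -> X;
  act_id : forall x, act (fun y => y) x = x;
  act_comp : forall g h, automorphism F g -> automorphism F h ->
    forall x, act (fun y => g (h y)) x = act g (act h x);
  act_cont : forall g x (W : X -> Prop), automorphism F g ->
    is_open ftop W -> W (act g x) ->
    exists (s : list F) (V : X -> Prop), is_open ftop V /\ V x /\
      forall h z, automorphism F h -> (forall y, In y s -> h y = g y) ->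
        V z -> W (act h z)
}.

Definition minimal_flow (F : structure L) (X : Type) (fX : Gflow F X) : Prop :=
  (exists x : X, True) /\
  forall C : X -> Prop,
    is_open (ftop fX) (fun x => ~ C x) ->
    (forall g x, automorphism F g -> C x -> C (act fX g x)) ->
    (forall x, ~ C x) \/ (forall x, C x).

Definition flow_hom (F : structure L) (X Y : Type) (fX : Gflow F X) (fY : Gflow F Y)
    (phi : X -> Y) : Prop :=
  (forall W, is_open (ftop fY) W -> is_open (ftop fX) (fun x => W (phi x))) /\
  (forall g x, automorphism F g -> phi (act fX g x) = act fY g (phi x)).

Definition universal_minimal_flow (F : structure L) (X : Type) (fX : Gflow F X) : Prop :=
  minimal_flow fX /\
  forall (Y : Type) (fY : Gflow F Y), minimal_flow fY ->
    exists phi : X -> Y, flow_hom fX fY phi /\ forall y, exists x, phi x = y.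

Definition at_most_points (X : Type) (d : nat) : Prop :=
  exists l : list X, length l <= d /\ forall x, In x l.

(* M(G_K) has at most d points (M(G) is unique up to isomorphism) *)
Definition UMF_at_most (F : structure L) (d : nat) : Prop :=
  forall (X : Type) (fX : Gflow F X), universal_minimal_flow fX -> at_most_points X d.

Definition ramsey_arrow (A B C : structure L) (k d : nat) : Prop :=
  forall chi : (A -> C) -> nat,
    (forall e, embedding A C e -> chi e < k) ->
    exists b : B -> C, embedding B C b /\
      exists l : list nat, length l <= d /\
        forall a : A -> B, embedding A B a -> In (chi (fun x => b (a x))) l.

Definition ramsey_bound (K : structure L -> Prop) (A : structure L) (d : nat) : Prop :=
  forall B, K B -> forall k, 2 <= k -> exists C, K C /\ ramsey_arrow A B C k d.

(* the Ramsey degree of A (least d with ramsey_bound, or infinity) is <= d *)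
Definition ramsey_degree_le (K : structure L -> Prop) (A : structure L) (d : nat) : Prop :=
  exists d', d' <= d /\ ramsey_bound K A d'.

(* the Ramsey degree of K (supremum over A in K) is <= d *)
Definition class_ramsey_degree_le (K : structure L -> Prop) (d : nat) : Prop :=
  forall A, K A -> ramsey_degree_le K A d.

End Structures.

(* Main.v *)
From Stdlib Require Import List Arith Lia.
From Stdlib Require Import ClassicalEpsilon FunctionalExtensionality.
From Stdlib Require Import PropExtensionality ProofIrrelevance.
From mathcomp Require classical_sets.
Require Import Defs.
Import ListNotations.
Set Implicit Arguments.

(** Both directions go through the automorphism group [G] of the limit [F], an embedding of a
    finite substructure into [F] being a coset of a pointwise stabilizer [G_s].

    If the Ramsey degree is at most [d], every minimal flow [X] has at most [d] points.
    Otherwise every orbit has [d + 1] points; by compactness finitely many pairs [(P, Q)] of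
    open sets, no [G_s]-orbit meeting both members of a pair, and finitely many group elements
    witness this at every point of [X]. Colouring an embedding by the sets [P] met by the
    corresponding [G_s]-orbit, the Ramsey property moves a base point to a [z] whose translates
    by these elements have only [d] colours, contradicting the pigeonhole principle. So some
    orbit has at most [d] points, and it is all of [X] by minimality.

    Conversely, the universal minimal flow is a minimal subflow of the space of ultrafilters of
    the algebra of the subsets of [G] invariant under some [G_s]. A colouring of the embeddings
    of [A] in [F] partitions [G] into such sets, so it has a value at every ultrafilter; if the
    minimal subflow has at most [d] points, the translates of one of its points have at most
    [d] values, and an element of [G] realizing finitely many of these is an embedding of [B]
    with at most [d] colours. *)

(** * Choice principles *)

Definition decb (P : Prop) : bool :=
  if excluded_middle_informative P then true else false.

Lemma decb_true (P : Prop) : decb P = true <-> P.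
Proof. unfold decb; destruct (excluded_middle_informative P); intuition congruence. Qed.

Lemma pred_ext (T : Type) (P Q : T -> Prop) : (forall x, P x <-> Q x) -> P = Q.
Proof.
  intros H; apply functional_extensionality; intros x.
  apply propositional_extensionality, H.
Qed.

Lemma sig_ext (T : Type) (P : T -> Prop) (x y : sig P) :
  proj1_sig x = proj1_sig y -> x = y.
Proof.
  destruct x as [x hx], y as [y hy]; simpl; intros e; subst y.
  f_equal; apply proof_irrelevance.
Qed.

(** Zorn's lemma is applied to the sets that satisfy [Phi] and contain [S0]; since [S0] bounds the
    empty chain, only nonempty chains enter the hypothesis. *)
Lemma zorn_sets (T : Type) (Phi : (T -> Prop) -> Prop) (S0 : T -> Prop) :
  Phi S0 ->
  (forall C : (T -> Prop) -> Prop, (exists S, C S) -> (forall S, C S -> Phi S) ->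
    (forall S S', C S -> C S' -> (forall x, S x -> S' x) \/ (forall x, S' x -> S x)) ->
    Phi (fun x => exists S, C S /\ S x)) ->
  exists M, Phi M /\ (forall x, S0 x -> M x) /\
    forall M', Phi M' -> (forall x, M x -> M' x) -> forall x, M' x -> M x.
Proof.
  intros H0 Hch.
  set (PE := fun S : T -> Prop => Phi S /\ forall x, S0 x -> S x).
  set (E := sig PE).
  set (le := fun S S' : E => decb (forall x, proj1_sig S x -> proj1_sig S' x)).
  assert (hle : forall S S', is_true (le S S') <->
      forall x, proj1_sig S x -> proj1_sig S' x) by (intros; apply decb_true).
  assert (Z : exists M : E, forall M', is_true (le M M') -> M' = M).
  { apply classical_sets.Zorn.
    - intros S; apply hle; auto.
    - intros S1 S2 S3; rewrite !hle; auto.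
    - intros S S'; rewrite !hle; intros h1 h2.
      apply sig_ext, pred_ext; split; auto.
    - intros A HA.
      destruct (classic (exists S, A S)) as [[S1 HS1]|HN].
      + assert (P1 : Phi (fun x => exists S, (exists S' : E, A S' /\ proj1_sig S' = S) /\ S x)).
        { apply Hch.
          - exists (proj1_sig S1), S1; auto.
          - intros S (S' & _ & <-); apply (proj2_sig S').
          - intros S S' (s & hs & <-) (s' & hs' & <-).
            destruct (HA s s' hs hs') as [h|h]; rewrite hle in h; auto. }
        assert (P2 : PE (fun x => exists S, (exists S' : E, A S' /\ proj1_sig S' = S) /\ S x)).
        { split; auto.
          intros x hx; exists (proj1_sig S1); split; [exists S1; auto|].
          apply (proj2_sig S1); auto. }
        exists (exist PE _ P2).
        intros S hS; apply hle; simpl; intros x hx.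
          exists (proj1_sig S); split; [exists S; auto|auto].
      + exists (exist PE S0 (conj H0 (fun x hx => hx))).
        intros S hS; destruct HN; eauto. }
  destruct Z as [M HM].
  exists (proj1_sig M); split; [|split]; try apply (proj2_sig M).
  intros M' HM' hsub.
  assert (P2 : forall x, S0 x -> M' x) by (intros x hx; apply hsub, (proj2_sig M); auto).
  specialize (HM (exist PE M' (conj HM' P2))).
  rewrite <- HM; [auto|]. apply hle; auto.
Qed.

(** * Ultrafilters *)

Record ultrafilter (T : Type) (U : (T -> Prop) -> Prop) : Prop := {
  uf_inter : forall P Q, U P -> U Q -> U (fun x => P x /\ Q x);
  uf_up : forall P Q : T -> Prop, U P -> (forall x, P x -> Q x) -> U Q;
  uf_inh : forall P, U P -> exists x, P x;
  uf_em : forall P, U P \/ U (fun x => ~ P x)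
}.

Arguments uf_inter [T U] _ [P Q].
Arguments uf_up [T U] _ [P Q].
Arguments uf_inh [T U] _ [P].

Definition fip (T : Type) (B : (T -> Prop) -> Prop) : Prop :=
  forall l : list (T -> Prop), (forall P, In P l -> B P) -> exists x, forall P, In P l -> P x.

Lemma fip_maximal_ultrafilter (T : Type) (U : (T -> Prop) -> Prop) :
  fip U -> (forall U', fip U' -> (forall P, U P -> U' P) -> forall P, U' P -> U P) ->
  ultrafilter U.
Proof.
  intros Hf Hmax.
  (* By maximality, a set meeting all finite intersections of members is a member. *)
  assert (Hin : forall P : T -> Prop, (forall l, (forall Q, In Q l -> U Q) ->
      exists x, P x /\ forall Q, In Q l -> Q x) -> U P).
  { intros P HP. apply (Hmax (fun Q => U Q \/ Q = P)); auto.
    intros l Hl.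
    assert (Hl' : exists l', (forall Q, In Q l' -> U Q) /\
        forall x, P x -> (forall Q, In Q l' -> Q x) -> forall Q, In Q l -> Q x).
    { induction l as [|Q l IH].
      - exists []; simpl; tauto.
      - destruct IH as (l' & h1 & h2); [intros; apply Hl; simpl; auto|].
        destruct (Hl Q (or_introl eq_refl)) as [HQ| ->].
        + exists (Q :: l'); split.
          * intros R [<-|HR]; auto.
          * intros x Px hx R [<-|HR]; [apply hx; simpl; auto|].
            apply (h2 x); auto. intros; apply hx; simpl; auto.
        + exists l'; split; auto. intros x Px hx R [<-|HR]; auto. eapply h2; eauto. }
    destruct Hl' as (l' & h1 & h2). destruct (HP l' h1) as (x & Px & hx).
    exists x; intros Q HQ; eapply h2; eauto. }
  split.
  - intros P Q HP HQ; apply Hin; intros l Hl.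
    destruct (Hf (P :: Q :: l)) as [x hx].
    + intros R [<-|[<-|HR]]; auto.
    + exists x; split; [split|]; intros; apply hx; simpl; auto.
  - intros P Q HP HPQ; apply Hin; intros l Hl.
    destruct (Hf (P :: l)) as [x hx].
    + intros R [<-|HR]; auto.
    + exists x; split; [apply HPQ|intros]; apply hx; simpl; auto.
  - intros P HP. destruct (Hf [P]) as [x hx].
    + intros R [<-|[]]; auto.
    + exists x; apply hx; simpl; auto.
  (* If neither [P] nor its complement is a member, [Hin] yields a finite family [l] with no common
     point in [P] and a finite family [l'] with none outside [P]; a common point of [l ++ l'] is
     impossible. *)
  - intros P. apply NNPP; intros HN. apply HN; left; apply Hin; intros l Hl.
    apply NNPP; intros h1. apply HN; right; apply Hin; intros l' Hl'.
    apply NNPP; intros h2.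
    destruct (Hf (l ++ l')) as [x hx].
    + intros R HR; apply in_app_or in HR; destruct HR; auto.
    + destruct (classic (P x)) as [Px|Px].
      * apply h1; exists x; split; auto; intros; apply hx, in_or_app; auto.
      * apply h2; exists x; split; auto; intros; apply hx, in_or_app; auto.
Qed.

(** Zorn's lemma applies because a finite subfamily of the union of a chain already lies in one
    member of the chain. *)
Lemma ultrafilter_extension (T : Type) (B : (T -> Prop) -> Prop) :
  fip B -> exists U, ultrafilter U /\ forall P, B P -> U P.
Proof.
  intros HB.
  destruct (@zorn_sets (T -> Prop) (@fip T) B HB) as (U & HU & hsub & hmax).
  - intros C [S HS] HC Hch l Hl.
    assert (H : exists S', C S' /\ forall P, In P l -> S' P).
    { induction l as [|P l IH].
      - exists S; simpl; tauto.
      - destruct IH as (S1 & h1 & h2); [intros; apply Hl; simpl; auto|].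
        destruct (Hl P (or_introl eq_refl)) as (S2 & h3 & h4).
        destruct (Hch S1 S2 h1 h3) as [h|h].
        + exists S2; split; auto; intros Q [<-|HQ]; auto.
        + exists S1; split; auto; intros Q [<-|HQ]; auto. }
    destruct H as (S' & h1 & h2). apply (HC S'); auto.
  - exists U; split; auto using fip_maximal_ultrafilter.
Qed.

Lemma uf_list (T I : Type) (U : (T -> Prop) -> Prop) (P : I -> T -> Prop) (l : list I) :
  ultrafilter U -> (forall i, In i l -> U (P i)) -> U (fun x => forall i, In i l -> P i x).
Proof.
  intros HU; induction l as [|i l IH]; intros Hl.
  - destruct (uf_em HU (fun _ => True)) as [h|h].
    + eapply uf_up; eauto; simpl; tauto.
    + destruct (uf_inh HU h) as [x hx]; tauto.
  - eapply (uf_up HU).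
    + apply (uf_inter HU (P := P i)); [apply Hl; simpl; auto|].
      apply IH; intros; apply Hl; simpl; auto.
    + simpl; intros x [h1 h2] j [<-|hj]; auto.
Qed.

Lemma uf_not (T : Type) (U : (T -> Prop) -> Prop) (P : T -> Prop) :
  ultrafilter U -> U (fun x => ~ P x) -> ~ U P.
Proof.
  intros HU h1 h2. destruct (uf_inh HU (uf_inter HU h1 h2)) as [x hx]; tauto.
Qed.

Lemma uf_bounded_value (T : Type) (U : (T -> Prop) -> Prop) (f : T -> nat) (k : nat) :
  ultrafilter U -> U (fun x => f x < k) -> exists i, i < k /\ U (fun x => f x = i).
Proof.
  intros HU; induction k as [|k IH]; intros Hk.
  - destruct (uf_inh HU Hk); lia.
  - destruct (uf_em HU (fun x => f x = k)) as [h|h]; [exists k; auto|].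
    destruct IH as (i & h1 & h2); [|exists i; split; [lia|auto]].
    eapply (uf_up HU); [exact (uf_inter HU Hk h)|]. simpl; intros; lia.
Qed.

(** * Finite combinatorics *)

(** Greedy choice: if it stopped after at most [d] elements, their values would cover the whole
    range of [f]. *)
Lemma uncovered_NoDup (X G : Type) (f : G -> X) (d : nat) :
  ~ (exists l : list X, length l <= d /\ forall g, In (f g) l) ->
  exists gs : list G, length gs = S d /\ NoDup (map f gs).
Proof.
  intros H.
  assert (E : forall n, n <= S d -> exists gs : list G, length gs = n /\ NoDup (map f gs)).
  { induction n as [|n IH]; intros Hn.
    - exists []; split; [auto|constructor].
    - destruct IH as (gs & h1 & h2); [lia|].
      destruct (classic (exists g, ~ In (f g) (map f gs))) as [[g hg]|hN].
      + exists (g :: gs); split; [simpl; lia|constructor; auto].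
      + destruct H. exists (map f gs); split; [rewrite length_map; lia|].
        intros g; apply NNPP; intros h; apply hN; eauto. }
  apply E; auto.
Qed.

Lemma pigeonhole_map (X G C : Type) (f : G -> X) (c : G -> C) (gs : list G) (l : list C) :
  NoDup (map f gs) -> length l < length gs -> (forall g, In g gs -> In (c g) l) ->
  exists g g', In g gs /\ In g' gs /\ f g <> f g' /\ c g = c g'.
Proof.
  intros Hnd Hlen Hc. apply NNPP; intros HN.
  assert (ND : NoDup (map c gs)).
  { clear Hlen Hc. induction gs as [|g gs IH]; [constructor|].
    inversion Hnd as [|? ? h1 h2]; subst. simpl; constructor.
    - intros h; apply in_map_iff in h; destruct h as (g' & e & hg').
      apply HN; exists g', g; repeat split; simpl; auto.
      intros e'; apply h1; rewrite <- e'; apply in_map; auto.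
    - apply IH; auto. intros (a & b & h3 & h4 & h5); apply HN; exists a, b; simpl; tauto. }
  assert (Hi : incl (map c gs) l).
  { intros y hy; apply in_map_iff in hy; destruct hy as (g & <- & hg); auto. }
  pose proof (NoDup_incl_length ND Hi) as h. rewrite length_map in h; lia.
Qed.

(** Colours are natural numbers below a bound, so a pattern of booleans is turned into its binary
    value. *)
Fixpoint bits_code (l : list bool) : nat :=
  match l with [] => 0 | b :: l => (if b then 1 else 0) + 2 * bits_code l end.

Lemma bits_code_bound l : bits_code l < 2 ^ length l.
Proof. induction l as [|[] l IH]; simpl; lia. Qed.

Lemma bits_code_inj l : forall l', length l = length l' -> bits_code l = bits_code l' -> l = l'.
Proof.
  induction l as [|b l IH]; intros [|b' l'] h1 h2; simpl in *; try lia; auto.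
  injection h1 as h1. destruct b, b'; try lia; f_equal; apply IH; auto; lia.
Qed.

(** Used to list the embeddings of [A] in [B], so that a finite intersection of ultrafilter members
    controls all of them. *)
Lemma finite_function_space (A B : Type) (lA : list A) (lB : list B) :
  (forall x, In x lA) -> (forall y, In y lB) ->
  exists l : list (A -> B), forall f, In f l.
Proof.
  intros HA HB.
  (* The tabulation below starts from a constant function, hence needs a point [b0]; if [B] is
     empty, there is at most one function. *)
  destruct (classic (exists b : B, True)) as [[b0 _]|HN].
  2:{ destruct (classic (exists f : A -> B, True)) as [[f0 _]|HN'].
      - exists [f0]; intros f; left. apply functional_extensionality; intros x.
        destruct HN; exists (f x); auto.
      - exists []; intros f; destruct HN'; eauto. }
  assert (E : forall l : list A, exists fs : list (A -> B),
      forall f : A -> B, exists g, In g fs /\ forall x, In x l -> g x = f x).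
  { induction l as [|a l (fs & IH)].
    - exists [fun _ => b0]; intros f; exists (fun _ => b0); simpl; tauto.
    - set (upd := fun (g : A -> B) (y : B) (x : A) =>
        if excluded_middle_informative (x = a) then y else g x).
      exists (flat_map (fun g => map (upd g) lB) fs).
      intros f. destruct (IH f) as (g & h1 & h2).
      exists (upd g (f a)); split.
      + apply in_flat_map; exists g; split; auto. apply in_map; auto.
      + intros x hx; unfold upd.
        destruct (excluded_middle_informative (x = a)) as [->|ne]; auto.
        destruct hx as [<-|hx]; [congruence|auto]. }
  destruct (E lA) as [fs Hfs]. exists fs; intros f.
  destruct (Hfs f) as (g & h1 & h2).
  replace f with g; auto. apply functional_extensionality; auto.
Qed.

(** * Topology *)

Section Topology.
Variables (X : Type) (T : topology X).

(** [W] is the union of all the open sets that it contains, so no neighbourhoods have to be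
    chosen. *)
Lemma open_local (W : X -> Prop) :
  (forall x, W x -> exists V, is_open T V /\ V x /\ forall y, V y -> W y) -> is_open T W.
Proof.
  intros H.
  set (I := {V : X -> Prop | is_open T V /\ forall y, V y -> W y}).
  replace W with (fun x => exists i : I, proj1_sig i x).
  - apply open_union; intros [V hV]; apply hV.
  - apply pred_ext; intros x; split.
    + intros [[V hV] hx]; apply hV, hx.
    + intros hx; destruct (H x hx) as (V & h1 & h2 & h3).
      exists (exist _ V (conj h1 h3)); auto.
Qed.

Lemma open_inter_list (I : Type) (U : I -> X -> Prop) (l : list I) :
  (forall i, In i l -> is_open T (U i)) -> is_open T (fun x => forall i, In i l -> U i x).
Proof.
  induction l as [|i l IH]; intros H.
  - replace (fun x : X => forall i, In i [] -> U i x) with (fun _ : X => True).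
    + apply open_full.
    + apply pred_ext; simpl; tauto.
  - replace (fun x => forall j, In j (i :: l) -> U j x)
      with (fun x => U i x /\ forall j, In j l -> U j x).
    + apply open_inter; [apply H; simpl; auto|apply IH; intros; apply H; simpl; auto].
    + apply pred_ext; simpl; intros x; split.
      * intros [h1 h2] j [<-|hj]; auto.
      * intros h; split; auto.
Qed.

Lemma hausdorff_finite_closed (l : list X) :
  hausdorff T -> is_open T (fun x => ~ In x l).
Proof.
  intros HT. replace (fun x => ~ In x l) with (fun x => forall y, In y l -> x <> y).
  - apply open_inter_list; intros y _. apply open_local; intros x hx.
    destruct (HT x y hx) as (U & V & h1 & h2 & h3 & h4 & h5).
    exists U; repeat split; auto. intros z hz ->; apply (h5 y); auto.
  - apply pred_ext; intros x; split.
    + intros h hx; apply (h x hx eq_refl).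
    + intros h y hy ->; auto.
Qed.

(** The space is covered by [W] (index [None]) and by the open sets disjoint from some neighbourhood
    of [p]. From a finite subcover, [P] is the intersection of these neighbourhoods and [Q] the
    union of the sets they avoid. *)
Lemma compact_hausdorff_regular (p : X) (W : X -> Prop) :
  compact T -> hausdorff T -> is_open T W -> W p ->
  exists P Q, is_open T P /\ is_open T Q /\ P p /\
    (forall x, ~ (P x /\ Q x)) /\ (forall x, W x \/ Q x).
Proof.
  intros HC HH HW Hp.
  set (J := {PQ : (X -> Prop) * (X -> Prop) | is_open T (fst PQ) /\ is_open T (snd PQ) /\
     fst PQ p /\ forall x, ~ (fst PQ x /\ snd PQ x)}).
  destruct (HC (option J) (fun o => match o with None => W | Some j => snd (proj1_sig j) end))
    as [l Hl].
  - intros [[[P Q] h]|]; [apply h|auto].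
  - intros x. destruct (classic (W x)) as [h|h]; [exists None; auto|].
    destruct (HH p x) as (P & Q & h1 & h2 & h3 & h4 & h5); [intros ->; auto|].
    unshelve eexists (Some (exist _ (P, Q) _)); simpl; auto.
  - exists (fun x => forall o, In o l -> match o with None => True | Some j => fst (proj1_sig j) x end),
      (fun x => exists j, In (Some j) l /\ snd (proj1_sig j) x).
    repeat split.
    + apply (open_inter_list (fun o x => match o with None => True | Some j => fst (proj1_sig j) x end)).
      intros [[[P Q] h]|] _; [apply h|apply open_full].
    + apply open_local; intros x (j & h1 & h2). exists (snd (proj1_sig j)).
      repeat split; eauto. apply (proj2_sig j).
    + intros [[[P Q] h]|] _; [apply h|auto].
    + intros x [h1 (j & h2 & h3)]. apply (proj2 (proj2 (proj2 (proj2_sig j))) x).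
      split; auto. apply (h1 _ h2).
    + intros x; destruct (Hl x) as ([j|] & h1 & h2); eauto.
Qed.

End Topology.

(** Separate a point [y] off the image from each value of [phi]; finitely many of these separations
    suffice, and intersecting their neighbourhoods of [y] avoids the image. *)
Lemma compact_image_closed (X Y : Type) (TX : topology X) (TY : topology Y) (phi : X -> Y) :
  compact TX -> hausdorff TY ->
  (forall W, is_open TY W -> is_open TX (fun x => W (phi x))) ->
  is_open TY (fun y => ~ exists x, phi x = y).
Proof.
  intros HC HH Hphi. apply open_local; intros y hy.
  set (J := {UV : (Y -> Prop) * (Y -> Prop) | is_open TY (fst UV) /\ is_open TY (snd UV) /\
     snd UV y /\ forall z, ~ (fst UV z /\ snd UV z)}).
  destruct (HC J (fun j x => fst (proj1_sig j) (phi x))) as [l Hl].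
  - intros j; apply Hphi, (proj2_sig j).
  - intros x. destruct (HH (phi x) y) as (U & V & h1 & h2 & h3 & h4 & h5); [eauto|].
    unshelve eexists (exist _ (U, V) _); simpl; auto.
  - exists (fun z => forall j, In j l -> snd (proj1_sig j) z); repeat split.
    + apply (open_inter_list TY (fun j : J => snd (proj1_sig j))).
      intros j _; apply (proj2_sig j).
    + intros j _; apply (proj2_sig j).
    + intros z hz [x <-]. destruct (Hl x) as (j & h1 & h2).
      apply (proj2 (proj2 (proj2 (proj2_sig j))) (phi x)); auto.
Qed.

(** * Substructures and the automorphism group *)

Lemma embedding_comp (L : language) (A B C : structure L) (e : A -> B) (f : B -> C) :
  embedding A B e -> embedding B C f -> embedding A C (fun x => f (e x)).
Proof.
  intros (h1 & h2 & h3) (k1 & k2 & k3); repeat split.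
  - intros x y h; apply h1, k1, h.
  - intros s xs; rewrite h2, k2; auto.
  - intros h; apply k3 with (xs := fun i => e (xs i)), h3, h.
  - intros h; apply h3, k3, h.
Qed.

Lemma generated_fclosed (L : language) (A : structure L) (s : list A) :
  fclosed A (generated A s).
Proof. intros f xs Hxs P HP Hs. apply HP; intros i; apply Hxs; auto. Qed.

Lemma generated_incl (L : language) (A : structure L) (s t : list A) (x : A) :
  incl s t -> generated A s x -> generated A t x.
Proof. intros Hst Hx P HP Ht. apply Hx; auto. Qed.

Lemma generated_in (L : language) (A : structure L) (s : list A) (x : A) :
  In x s -> generated A s x.
Proof. intros Hx P HP Hs; auto. Qed.

Definition gen_sub (L : language) (A : structure L) (s : list A) : structure L := {|
  carrier := {x : A | generated A s x};
  finterp := fun f xs => exist _ (finterp A f (fun i => proj1_sig (xs i)))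
                          (generated_fclosed f (fun i => proj1_sig (xs i)) (fun i => proj2_sig (xs i)));
  rinterp := fun r xs => rinterp A r (fun i => proj1_sig (xs i))
|}.

Lemma gen_sub_embedding (L : language) (A : structure L) (s : list A) :
  embedding (gen_sub A s) A (@proj1_sig _ _).
Proof. repeat split; auto. intros x y; apply sig_ext. Qed.

Lemma embedding_gen_sub (L : language) (A B : structure L) (s : list B) (e : A -> gen_sub B s) :
  embedding A B (fun x => proj1_sig (e x)) -> embedding A (gen_sub B s) e.
Proof.
  intros (h1 & h2 & h3); split; [|split].
  - intros x y h; apply h1; rewrite h; auto.
  - intros f xs; apply sig_ext; apply h2.
  - intros r xs; apply h3.
Qed.

Lemma gen_sub_finitely_generated (L : language) (A : structure L) (s : list A) :
  finitely_generated (gen_sub A s).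
Proof.
  assert (Hs : exists s' : list (gen_sub A s), forall y, In (proj1_sig y) s -> In y s').
  { assert (H : forall t, incl t s -> exists s' : list (gen_sub A s),
        forall y, In (proj1_sig y) t -> In y s').
    { induction t as [|a t IH]; intros Ht.
      - exists []; simpl; auto.
      - destruct IH as [s' Hs']; [intros y hy; apply Ht; simpl; auto|].
        assert (Ha : generated A s a) by (apply generated_in, Ht; simpl; auto).
        exists (exist _ a Ha :: s'); intros y [h|h]; [left|right; auto].
        apply sig_ext; auto. }
    apply H; apply incl_refl. }
  destruct Hs as [s' Hs']. exists s'. intros [x Hx] P HP Hin.
  (* [P] lives on the subtype, whereas generation in [A] tests predicates on [A]; membership is
     therefore proved along the way, and [P] is asked for every proof of it. *)
  assert (H : generated A s x /\ forall H, P (exist _ x H)); [|apply H].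
  apply (Hx (fun z => generated A s z /\ forall H, P (exist _ z H))).
  - intros f xs Hxs. split; [apply generated_fclosed, Hxs|].
    intros H. set (ys := fun i => exist (generated A s) (xs i) (proj1 (Hxs i))).
    refine (eq_ind (finterp (gen_sub A s) f ys) P (HP f ys _) _ _).
    + intros i; apply Hxs.
    + apply sig_ext; reflexivity.
  - intros y hy; split; [apply generated_in; auto|].
    intros H; apply Hin, Hs'; auto.
Qed.

Lemma gen_sub_in_class (L : language) (K : structure L -> Prop) (F : structure L) (s : list F) :
  is_fraisse_limit K F -> K (gen_sub F s).
Proof.
  intros (_ & _ & _ & HK). apply HK; split.
  - apply gen_sub_finitely_generated.
  - exists (@proj1_sig _ _); apply gen_sub_embedding.
Qed.

Definition Aut (L : language) (F : structure L) := {g : F -> F | automorphism F g}.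
Definition ap (L : language) (F : structure L) (g : Aut F) : F -> F := proj1_sig g.
Coercion ap : Aut >-> Funclass.

Section AutomorphismGroup.
Variables (L : language) (F : structure L).
Implicit Types g h : Aut F.

Lemma aut_ext g h : (forall x, g x = h x) -> g = h.
Proof. intros H; apply sig_ext, functional_extensionality, H. Qed.

Lemma aut_embedding g : embedding F F g.
Proof. apply (proj2_sig g). Qed.

Lemma automorphism_one : automorphism F (fun x => x).
Proof. split; [repeat split; auto|eauto]. Qed.

Lemma automorphism_mul g h : automorphism F (fun x => g (h x)).
Proof.
  split.
  - apply (embedding_comp (aut_embedding h) (aut_embedding g)).
  - intros y; destruct (proj2 (proj2_sig g) y) as [z <-].
    destruct (proj2 (proj2_sig h) z) as [x <-]. exists x; auto.
Qed.

Definition aut_preim g (y : F) : F :=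
  proj1_sig (constructive_indefinite_description _ (proj2 (proj2_sig g) y)).

Lemma aut_preimK g y : g (aut_preim g y) = y.
Proof. unfold aut_preim; destruct constructive_indefinite_description; auto. Qed.

Lemma automorphism_inv g : automorphism F (aut_preim g).
Proof.
  destruct (aut_embedding g) as (h1 & h2 & h3).
  split; [split; [|split]|].
  - intros x y h; rewrite <- (aut_preimK g x), <- (aut_preimK g y), h; auto.
  - intros f xs; apply h1. rewrite h2, aut_preimK. f_equal.
    apply functional_extensionality; intros i; rewrite aut_preimK; auto.
  - intros r xs. rewrite (h3 r (fun i => aut_preim g (xs i))). replace (fun i => g (aut_preim g (xs i))) with xs; [tauto|].
    apply functional_extensionality; intros i; rewrite aut_preimK; auto.
  - intros y; exists (g y); apply h1, aut_preimK.
Qed.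

Definition aut_one : Aut F := exist _ _ automorphism_one.
Definition aut_mul g h : Aut F := exist _ _ (automorphism_mul g h).
Definition aut_inv g : Aut F := exist _ _ (automorphism_inv g).

Lemma aut_invK g x : g (aut_inv g x) = x.
Proof. apply aut_preimK. Qed.

Lemma aut_Kinv g x : aut_inv g (g x) = x.
Proof. apply (proj1 (aut_embedding g)), aut_invK. Qed.

Definition fixes (s : list F) g : Prop := forall y, In y s -> g y = y.

End AutomorphismGroup.
Arguments aut_one {L F}.

(** * Flows *)

Section Flows.
Variables (L : language) (F : structure L) (X : Type) (fX : Gflow F X).

Definition gact (g : Aut F) (x : X) : X := act fX g x.

Lemma gact_one x : gact aut_one x = x.
Proof. apply act_id. Qed.

Lemma gact_mul g h x : gact (aut_mul g h) x = gact g (gact h x).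
Proof. exact (act_comp fX (proj2_sig g) (proj2_sig h) x). Qed.

Lemma gact_invK g x : gact g (gact (aut_inv g) x) = x.
Proof.
  rewrite <- gact_mul. rewrite <- (gact_one x) at 2. f_equal.
  apply aut_ext; intros y; apply aut_invK.
Qed.

Lemma gact_Kinv g x : gact (aut_inv g) (gact g x) = x.
Proof.
  rewrite <- gact_mul. rewrite <- (gact_one x) at 2. f_equal.
  apply aut_ext; intros y; apply aut_Kinv.
Qed.

Lemma gact_preimage_open g (W : X -> Prop) :
  is_open (ftop fX) W -> is_open (ftop fX) (fun x => W (gact g x)).
Proof.
  intros HW. apply open_local; intros x hx.
  destruct (act_cont fX x W (proj2_sig g) HW hx) as (s & V & h1 & h2 & h3).
  exists V; repeat split; auto. intros y hy. apply h3; auto. exact (proj2_sig g).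
Qed.

(* A Lebesgue number lemma: pointwise stabilizers play the role of small radii. *)
Lemma flow_lebesgue (I : Type) (U : I -> X -> Prop) :
  (forall i, is_open (ftop fX) (U i)) -> (forall x, exists i, U i x) ->
  exists s : list F, forall z, exists i, forall v, fixes s v -> U i (gact v z).
Proof.
  intros HU Hc.
  set (PJ := fun j : I * list F * (X -> Prop) =>
    let '(i, s, V) := j in is_open (ftop fX) V /\
      forall v z, fixes s v -> V z -> U i (gact v z)).
  destruct (fcompact fX (fun (j : sig PJ) => snd (proj1_sig j))) as [l Hl].
  - intros [[[i s] V] h]; apply h.
  - intros x. destruct (Hc x) as [i hi].
    assert (hi' : U i (act fX (fun y => y) x)) by (rewrite act_id; auto).
    destruct (act_cont fX x (U i) (automorphism_one F) (HU i) hi') as (s & V & h1 & h2 & h3).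
    assert (h : PJ (i, s, V)).
    { split; auto. intros v z hv hz. apply h3; auto. exact (proj2_sig v). }
    exists (exist _ _ h); auto.
  - exists (flat_map (fun j => snd (fst (proj1_sig j))) l).
    intros z. destruct (Hl z) as ([[[i s] V] [h1 h2]] & hj & hz); simpl in hz.
    exists i; intros v hv; apply h2; auto.
    intros y hy; apply hv, in_flat_map; eexists; split; [exact hj|auto].
Qed.

(** No orbit of the stabilizer [G_s] meets both sets: a uniform form of disjointness. *)
Definition unif_separated (s : list F) (P Q : X -> Prop) : Prop :=
  forall z v w, fixes s v -> fixes s w -> ~ (P (gact v z) /\ Q (gact w z)).

(** Regularity is used twice: [P] is disjoint from a [Q] covering the complement of [W], and [P'] is
    disjoint from a [Q'] covering the complement of [P]. For a suitable [s] each [G_s]-orbit lies in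
    [P], hence misses [Q], or lies in [Q'], hence misses [P']. *)
Lemma flow_unif_regular (p : X) (W : X -> Prop) :
  is_open (ftop fX) W -> W p ->
  exists s P Q, is_open (ftop fX) P /\ is_open (ftop fX) Q /\ P p /\
    (forall x, W x \/ Q x) /\ unif_separated s P Q.
Proof.
  intros HW Hp.
  destruct (compact_hausdorff_regular p W (fcompact fX) (fhausdorff fX) HW Hp)
    as (P & Q & h1 & h2 & h3 & h4 & h5).
  destruct (compact_hausdorff_regular p P (fcompact fX) (fhausdorff fX) h1 h3)
    as (P' & Q' & k1 & k2 & k3 & k4 & k5).
  destruct (@flow_lebesgue bool (fun b => if b then P else Q')) as [s Hs].
  - intros []; auto.
  - intros x; destruct (k5 x); [exists true|exists false]; auto.
  - exists s, P', Q; repeat split; auto.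
    intros z v w hv hw [m1 m2]. destruct (Hs z) as [[] hz].
    + apply (h4 (gact w z)); auto.
    + apply (k4 (gact v z)); auto.
Qed.

Lemma flow_unif_separation (p q : X) : p <> q ->
  exists s P Q, is_open (ftop fX) P /\ is_open (ftop fX) Q /\ P p /\ Q q /\
    unif_separated s P Q.
Proof.
  intros Hpq. destruct (fhausdorff fX Hpq) as (W & V & h1 & h2 & h3 & h4 & h5).
  destruct (flow_unif_regular p W h1 h3) as (s & P & Q & k1 & k2 & k3 & k4 & k5).
  exists s, P, Q; repeat split; auto.
  destruct (k4 q) as [h|h]; auto. destruct (h5 q); auto.
Qed.

End Flows.

(** * A bounded Ramsey degree bounds the minimal flows *)

Lemma generated_map (L : language) (A B : structure L) (e : A -> B) (s : list A) (x : A) :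
  embedding A B e -> generated A s x -> generated B (map e s) (e x).
Proof.
  intros (_ & He & _) Hx P HP Hs. apply (Hx (fun y => P (e y))).
  - intros f xs Hxs. rewrite He. apply HP; auto.
  - intros y hy; apply Hs, in_map, hy.
Qed.

Lemma fixes_generated (L : language) (F : structure L) (s : list F) (v : Aut F) (x : F) :
  fixes s v -> generated F s x -> v x = x.
Proof.
  intros Hv Hx. apply (Hx (fun y => v y = y)); auto.
  intros f xs Hxs. rewrite (proj1 (proj2 (aut_embedding v))). f_equal.
  apply functional_extensionality; auto.
Qed.

Lemma ramsey_arrow_embeds (L : language) (A B C D : structure L) (k d : nat) :
  embeds C D -> ramsey_arrow A B C k d -> ramsey_arrow A B D k d.
Proof.
  intros [e He] H chi Hchi.
  destruct (H (fun f => chi (fun x => e (f x)))) as (b & hb & l & h1 & h2).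
  - intros f Hf; apply Hchi, (embedding_comp Hf He).
  - exists (fun x => e (b x)); split; [apply (embedding_comp hb He)|eauto].
Qed.

Section SmallOrbit.
Variables (L : language) (K : structure L -> Prop) (F : structure L) (d : nat).
Hypothesis HF : is_fraisse_limit K F.
Hypothesis HR : class_ramsey_degree_le K d.
Variables (X : Type) (fX : Gflow F X).

(** Saturating [P] under [G_s] makes the condition constant on [G_s]-orbits, so that it can be read
    off from a coset of [G_s]. *)
Definition meets (s : list F) (z : X) (P : X -> Prop) : Prop :=
  exists v, fixes s v /\ P (gact fX v z).

Definition pattern (s : list F) (Ps : list (X -> Prop)) (z : X) : list bool :=
  map (fun P => decb (meets s z P)) Ps.

(* An embedding [e] of the substructure generated by [s] determines the coset of the
   [g] with [g o e = id], hence the pattern of [g y0]; this is the colour of [e]. *)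
Lemma few_patterns (y0 : X) (s : list F) (Ps : list (X -> Prop)) (gs : list (Aut F)) :
  exists z, exists l : list nat, length l <= d /\
    forall g, In g gs -> In (bits_code (pattern s Ps (gact fX g z))) l.
Proof.
  set (A := gen_sub F s).
  (* [B] contains [g^{-1} s] for every [g] in [gs], so each [g^{-1}] restricts to an embedding of
     [A] in [B]. *)
  set (B := gen_sub F (flat_map (fun g => map (aut_inv g) s) gs)).
  destruct HF as (_ & _ & Hhom & HK).
  destruct (HR (gen_sub_in_class s HF)) as (d' & Hd' & Hram).
  (* There are [2 ^ length Ps] codes; the summand [2] secures the condition [2 <= k]. *)
  destruct (Hram B (gen_sub_in_class _ HF) (2 + 2 ^ length Ps)) as (C & HC & Harr); [lia|].
  assert (Harr' : ramsey_arrow A B F (2 + 2 ^ length Ps) d').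
  { apply (ramsey_arrow_embeds (proj2 (proj2 (HK C) HC)) Harr). }
  destruct (Harr' (fun e => bits_code (map (fun P =>
      decb (exists g : Aut F, (forall x, g (e x) = proj1_sig x) /\ P (gact fX g y0))) Ps)))
    as (b & Hb & l & Hl & Hin).
  { intros e _. eapply Nat.lt_le_trans; [apply bits_code_bound|]. rewrite length_map; lia. }
  (* By homogeneity [b] is the restriction of an automorphism [h]; the required point is
     [z = h^{-1} y0]. *)
  destruct (Hhom B (@proj1_sig _ _) b (gen_sub_finitely_generated F _)
    (gen_sub_embedding F _) Hb) as (h0 & Hh0 & Hh).
  set (h := exist _ h0 Hh0 : Aut F).
  exists (gact fX (aut_inv h) y0), l; split; [lia|]. intros g Hg.
  assert (Ha : forall x : A, generated F (flat_map (fun g => map (aut_inv g) s) gs)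
      (aut_inv g (proj1_sig x))).
  { intros [x Hx]; simpl.
    apply generated_incl with (s := map (aut_inv g) s).
    - intros y hy; apply in_flat_map; eauto.
    - apply (generated_map (aut_embedding (aut_inv g)) Hx). }
  set (a := fun x : A => exist _ _ (Ha x) : B).
  assert (Hae : embedding A B a).
  { apply embedding_gen_sub; simpl.
    apply (embedding_comp (gen_sub_embedding F s) (aut_embedding (aut_inv g))). }
  specialize (Hin a Hae). match type of Hin with In ?c l => replace (bits_code _) with c; auto end.
  f_equal. apply map_ext; intros P. f_equal. apply propositional_extensionality.
  (* Hence the automorphisms that invert [b o a] on [A] form the coset [G_s g h^{-1}], and they
     carry [y0] exactly onto the [G_s]-orbit of [g z]. *)
  assert (Hba : forall x, b (a x) = h (aut_inv g (proj1_sig x))).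
  { intros x; rewrite <- Hh; reflexivity. }
  split.
  - intros (g' & h1 & h2). exists (aut_mul g' (aut_mul h (aut_inv g))); split.
    + intros y hy. pose proof (h1 (exist _ y (generated_in s y hy))) as h3.
      rewrite Hba in h3; exact h3.
    + rewrite !gact_mul, gact_Kinv, gact_invK; auto.
  - intros (v & h1 & h2). exists (aut_mul v (aut_mul g (aut_inv h))); split.
    + intros x; rewrite Hba. simpl. change (v (g (aut_inv h (h (aut_inv g (proj1_sig x))))) = proj1_sig x).
      rewrite aut_Kinv, aut_invK. apply (fixes_generated h1), (proj2_sig x).
    + rewrite !gact_mul; auto.
Qed.

Lemma unif_separated_incl (s t : list F) (P Q : X -> Prop) :
  incl s t -> unif_separated fX s P Q -> unif_separated fX t P Q.
Proof. intros Hst H z v w hv hw; apply H; intros y hy; auto. Qed.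

(** A witness at [z] that two points of the orbit of [y] differ; [z] is kept apart from [y] because
    one witness has to serve a whole neighbourhood of [y]. *)
Definition separates_orbit (Ts : list ((X -> Prop) * (X -> Prop))) (y z : X)
    (g g' : Aut F) : Prop :=
  gact fX g y <> gact fX g' y ->
  exists T, In T Ts /\ fst T (gact fX g z) /\ snd T (gact fX g' z).

(** Each pair with [g y <> g' y] contributes a uniformly separated pair of open sets; [V] shrinks so
    that the two translates of its points stay in these sets, and [s] grows. *)
Lemma orbit_separation (y : X) (l : list (Aut F * Aut F)) :
  exists V s Ts, is_open (ftop fX) V /\ V y /\
    (forall T, In T Ts -> unif_separated fX s (fst T) (snd T)) /\
    forall z g g', V z -> In (g, g') l -> separates_orbit Ts y z g g'.
Proof.
  induction l as [|[g g'] l (V & s & Ts & h1 & h2 & h3 & h4)].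
  - exists (fun _ => True), [], []; simpl; repeat split; try tauto. apply open_full.
  - destruct (classic (gact fX g y = gact fX g' y)) as [e|ne].
    + exists V, s, Ts; repeat split; auto.
      intros z k k' hz [[= <- <-]|hk]; auto. intros hne; contradiction.
    + destruct (flow_unif_separation fX ne) as (t & P & Q & k1 & k2 & k3 & k4 & k5).
      exists (fun z => V z /\ P (gact fX g z) /\ Q (gact fX g' z)), (s ++ t), ((P, Q) :: Ts).
      repeat split; auto.
      * apply open_inter; auto. apply open_inter; apply gact_preimage_open; auto.
      * intros T [<-|hT].
        -- apply (unif_separated_incl (s := t)); auto. apply incl_appr, incl_refl.
        -- apply (unif_separated_incl (s := s)); auto. apply incl_appl, incl_refl.
      * intros z m m' (hz & hP & hQ) [[= <- <-]|hm] hne.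
        -- exists (P, Q); simpl; auto.
        -- destruct (h4 z m m' hz hm hne) as (T & hT & hT'). exists T; simpl; auto.
Qed.

Lemma small_orbit (y0 : X) :
  exists y, exists l, length l <= d /\ forall g, In (gact fX g y) l.
Proof.
  apply NNPP; intros HN.
  (* An index of the cover: [d + 1] elements [gs] moving some [y] to distinct points, and an open
     [V] on which [s] and [Ts] witness this distinctness. *)
  set (PJ := fun j : list (Aut F) * (X -> Prop) * list F * list ((X -> Prop) * (X -> Prop)) =>
    let '(gs, V, s, Ts) := j in
    is_open (ftop fX) V /\ length gs = S d /\
    (forall T, In T Ts -> unif_separated fX s (fst T) (snd T)) /\
    exists y, NoDup (map (fun g => gact fX g y) gs) /\
      forall z g g', V z -> In g gs -> In g' gs -> separates_orbit Ts y z g g').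
  destruct (fcompact fX (fun j : sig PJ => snd (fst (fst (proj1_sig j))))) as [l Hl].
  - intros [[[[gs V] s] Ts] h]; apply h.
  - intros y. destruct (@uncovered_NoDup X (Aut F) (fun g => gact fX g y) d) as (gs & h1 & h2).
    { intros h; apply HN; exists y; auto. }
    destruct (orbit_separation y (list_prod gs gs)) as (V & s & Ts & k1 & k2 & k3 & k4).
    assert (h : PJ (gs, V, s, Ts)).
    { repeat split; auto. exists y; split; auto.
      intros z g g' hz hg hg'; apply k4; auto. apply in_prod; auto. }
    exists (exist _ _ h); auto.
  (* The data of the finite subcover are merged, so that a single colouring serves every point of
     the flow. *)
  - set (s := flat_map (fun j : sig PJ => snd (fst (proj1_sig j))) l).
    set (Ts := flat_map (fun j : sig PJ => snd (proj1_sig j)) l).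
    set (gs := flat_map (fun j : sig PJ => fst (fst (fst (proj1_sig j)))) l).
    destruct (few_patterns y0 s (map fst Ts) gs) as (z & lc & h1 & h2).
    destruct (Hl z) as ([[[[gs' V] s'] Ts'] hj] & hin & hz). simpl in hz.
    pose proof hj as (k1 & k2 & k3 & y & k4 & k5).
    assert (hs : incl s' s) by (intros x hx; apply in_flat_map; eexists; split; eauto).
    assert (hTs : incl Ts' Ts) by (intros x hx; apply in_flat_map; eexists; split; eauto).
    assert (hgs : incl gs' gs) by (intros x hx; apply in_flat_map; eexists; split; eauto).
    destruct (pigeonhole_map (fun g => gact fX g y)
      (fun g => bits_code (pattern s (map fst Ts) (gact fX g z))) gs' lc)
      as (g & g' & hg & hg' & hne & hc); auto; [lia|].
    apply bits_code_inj in hc; [|unfold pattern; rewrite !length_map; auto].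
    destruct (k5 z g g' hz hg hg' hne) as ([P Q] & hT & hP & hQ). simpl in hP, hQ.
    unfold pattern in hc.
    pose proof (ext_in_map hc P (in_map fst _ _ (hTs _ hT))) as e; cbv beta in e.
    (* The orbit of [g z] under [G_s] meets [P]; since the patterns agree, so does that of [g' z],
       although [g' z] lies in [Q]. *)
    assert (m : meets s (gact fX g z) P).
    { exists aut_one; split; [intros x _; auto|rewrite gact_one; auto]. }
    rewrite <- decb_true, e, decb_true in m. destruct m as (v & hv & hPv).
    assert (f1 : fixes s aut_one) by (intros x _; auto).
    apply (unif_separated_incl hs (k3 _ hT) (gact fX g' z) hv f1).
    rewrite gact_one; auto.
Qed.

Lemma minimal_flow_bounded : minimal_flow fX -> at_most_points X d.
Proof.
  intros [[y0 _] Hmin]. destruct (small_orbit y0) as (y & l & h1 & h2).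
  destruct (Hmin (fun x => exists g, gact fX g y = x)) as [h|h].
  (* [l] may contain points outside the orbit; after filtering, the orbit is a finite set, hence
     closed. *)
  - set (l' := filter (fun x => decb (exists g, gact fX g y = x)) l).
    replace (fun x => ~ exists g, gact fX g y = x) with (fun x => ~ In x l').
    + apply hausdorff_finite_closed, fhausdorff.
    + apply pred_ext; intros x. unfold l'; rewrite filter_In, decb_true. split.
      * intros hx [g hg]; apply hx; split; [rewrite <- hg; auto|eauto].
      * intros hx [_ h]; auto.
  - intros g x Hg [k <-]. exists (aut_mul (exist _ g Hg) k). apply gact_mul.
  - destruct (h y); exists aut_one; apply gact_one.
  - exists l; split; auto. intros x; destruct (h x) as [g <-]; auto.
Qed.

End SmallOrbit.

(** * Minimal subflows *)

Section Subflow.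
Variables (L : language) (F : structure L) (X : Type) (fX : Gflow F X) (C : X -> Prop).
Hypothesis HC : is_open (ftop fX) (fun x => ~ C x).
Hypothesis Hinv : forall g x, C x -> C (gact fX g x).

(** The subspace topology in local form, which makes closure under unions immediate. *)
Definition sub_open (O : sig C -> Prop) : Prop :=
  forall x, O x -> exists W, is_open (ftop fX) W /\ W (proj1_sig x) /\
    forall y : sig C, W (proj1_sig y) -> O y.

Lemma sub_open_full : sub_open (fun _ => True).
Proof. intros x _. exists (fun _ => True); repeat split; auto. apply open_full. Qed.

Lemma sub_open_inter U V : sub_open U -> sub_open V -> sub_open (fun x => U x /\ V x).
Proof.
  intros HU HV x [hU hV].
  destruct (HU x hU) as (W & h1 & h2 & h3), (HV x hV) as (W' & k1 & k2 & k3).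
  exists (fun y => W y /\ W' y); split; [|split]; auto.
  - apply open_inter; auto.
  - intros y []; auto.
Qed.

Lemma sub_open_union (I : Type) (U : I -> sig C -> Prop) :
  (forall i, sub_open (U i)) -> sub_open (fun x => exists i, U i x).
Proof.
  intros HU x [i hi]. destruct (HU i x hi) as (W & h1 & h2 & h3).
  exists W; repeat split; eauto.
Qed.

Definition sub_top : topology (sig C) :=
  Build_topology sub_open sub_open_full sub_open_inter sub_open_union.

(** A cover of [C] becomes a cover of [X] by adding the open complement of [C] as [None]. *)
Lemma sub_compact : compact sub_top.
Proof.
  intros I U HU Hcov.
  set (PJ := fun j : I * (X -> Prop) => is_open (ftop fX) (snd j) /\
    forall y : sig C, snd j (proj1_sig y) -> U (fst j) y).
  destruct (fcompact fX (fun o : option (sig PJ) => match o with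
      None => fun x => ~ C x | Some j => snd (proj1_sig j) end)) as [l Hl].
  - intros [[[i W] h]|]; [apply h|auto].
  - intros x. destruct (classic (C x)) as [hx|hx]; [|exists None; auto].
    destruct (Hcov (exist _ x hx)) as [i hi].
    destruct (HU i _ hi) as (W & h1 & h2 & h3).
    exists (Some (exist PJ (i, W) (conj h1 h3))); auto.
  - exists (flat_map (fun o => match o with None => [] | Some j => [fst (proj1_sig j)] end) l).
    intros [x hx]. destruct (Hl x) as ([j|] & h1 & h2); [|contradiction].
    exists (fst (proj1_sig j)); split.
    + apply in_flat_map; exists (Some j); simpl; auto.
    + apply (proj2_sig j); auto.
Qed.

Lemma sub_hausdorff : hausdorff sub_top.
Proof.
  intros x y hxy.
  destruct (fhausdorff fX (x := proj1_sig x) (y := proj1_sig y)) as (U & V & h1 & h2 & h3 & h4 & h5).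
  - intros e; apply hxy, sig_ext, e.
  - exists (fun z => U (proj1_sig z)), (fun z => V (proj1_sig z)); repeat split; auto.
    + intros z hz; exists U; auto.
    + intros z hz; exists V; auto.
Qed.

(* [act] takes arbitrary maps; outside of the automorphisms its value is junk. *)
Definition sub_act (g : F -> F) (x : sig C) : sig C :=
  match excluded_middle_informative (automorphism F g) with
  | left H => exist _ _ (Hinv (exist _ g H) (proj2_sig x))
  | right _ => x
  end.

Lemma sub_actE g x : automorphism F g -> proj1_sig (sub_act g x) = act fX g (proj1_sig x).
Proof. intros Hg; unfold sub_act; destruct excluded_middle_informative; tauto. Qed.

Lemma sub_act_id x : sub_act (fun y => y) x = x.
Proof. apply sig_ext; rewrite sub_actE; [apply act_id|apply automorphism_one]. Qed.

Lemma sub_act_comp g h : automorphism F g -> automorphism F h ->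
  forall x, sub_act (fun y => g (h y)) x = sub_act g (sub_act h x).
Proof.
  intros Hg Hh x; apply sig_ext. rewrite !sub_actE; auto.
  - apply act_comp; auto.
  - exact (automorphism_mul (exist _ g Hg) (exist _ h Hh)).
Qed.

Lemma sub_act_cont g x (W : sig C -> Prop) : automorphism F g ->
  is_open sub_top W -> W (sub_act g x) ->
  exists (s : list F) (V : sig C -> Prop), is_open sub_top V /\ V x /\
    forall h z, automorphism F h -> (forall y, In y s -> h y = g y) ->
      V z -> W (sub_act h z).
Proof.
  intros Hg HW hx. destruct (HW _ hx) as (W' & h1 & h2 & h3).
  rewrite sub_actE in h2; auto.
  destruct (act_cont fX (proj1_sig x) W' Hg h1 h2) as (s & V & k1 & k2 & k3).
  exists s, (fun z => V (proj1_sig z)); repeat split; auto.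
  - intros z hz; exists V; auto.
  - intros h z Hh hs hz. apply h3. rewrite sub_actE; auto.
Qed.

Definition subflow : Gflow F (sig C) :=
  Build_Gflow sub_compact sub_hausdorff sub_act sub_act_id sub_act_comp sub_act_cont.

(** A closed invariant subset of the subtype is pushed forward to [X], where it remains closed
    because [C] is closed. *)
Lemma subflow_minimal :
  (exists x, C x) ->
  (forall D : X -> Prop, is_open (ftop fX) (fun x => ~ D x) ->
    (forall g x, D x -> D (gact fX g x)) -> (forall x, D x -> C x) -> (exists x, D x) ->
    forall x, C x -> D x) ->
  minimal_flow subflow.
Proof.
  intros [x0 hx0] Hmin. split; [exists (exist _ x0 hx0); auto|].
  intros D HD Dinv.
  destruct (classic (exists x, D x)) as [[x hx]|HN]; [right|left; intros x hx; apply HN; eauto].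
  assert (H : forall y, C y -> exists h : C y, D (exist _ y h)).
  { apply Hmin.
    - apply open_local; intros y hy.
      destruct (classic (C y)) as [hC|hC].
      + destruct (HD (exist _ y hC)) as (W & h1 & h2 & h3); [intros h; eauto|].
        exists W; repeat split; auto. intros z hz [hz1 hz2]. apply (h3 (exist _ z hz1) hz hz2).
      + exists (fun z => ~ C z); repeat split; auto. intros z hz [h _]; auto.
    - intros g y [h1 h2]. exists (Hinv g h1).
      replace (exist _ _ _) with (sub_act g (exist _ y h1)).
      + apply Dinv; auto. exact (proj2_sig g).
      + apply sig_ext, sub_actE; exact (proj2_sig g).
    - intros y [h _]; auto.
    - destruct x as [y hy]; eauto. }
  intros [y hy]. destruct (H y hy) as [h1 h2]. rewrite (proof_irrelevance _ hy h1); auto.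
Qed.

End Subflow.

(** Zorn's lemma is applied to the complements: a maximal proper invariant open set is sought. *)
Lemma minimal_subset_exists (L : language) (F : structure L) (X : Type) (fX : Gflow F X) :
  (exists x : X, True) ->
  exists C : X -> Prop, is_open (ftop fX) (fun x => ~ C x) /\
    (forall g x, C x -> C (gact fX g x)) /\ (exists x, C x) /\
    forall D : X -> Prop, is_open (ftop fX) (fun x => ~ D x) ->
      (forall g x, D x -> D (gact fX g x)) -> (forall x, D x -> C x) -> (exists x, D x) ->
      forall x, C x -> D x.
Proof.
  intros [x0 _].
  destruct (@zorn_sets X (fun O => is_open (ftop fX) O /\
      (forall g x, ~ O x -> ~ O (gact fX g x)) /\ exists x, ~ O x) (fun _ => False))
    as (O & (h1 & h2 & h3) & _ & Hmax).
  - split; [|split]; eauto. apply open_local; tauto.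
  - intros Ch [S0 HS0] HCh Htot; split; [|split].
    + apply open_local; intros x (S & h1 & h2). exists S; repeat split; eauto. apply HCh; auto.
    + intros g x hx (S & h1 & h2).
      destruct (HCh S h1) as (_ & h3 & _). apply (h3 g x); eauto.
    + (* By compactness a chain of proper open sets does not cover. *)
      apply NNPP; intros HN.
      destruct (fcompact fX (fun S : sig Ch => proj1_sig S)) as [l Hl].
      * intros [S hS]; apply HCh; auto.
      * intros x. apply NNPP; intros hx. apply HN; exists x. intros (S & h1 & h2).
        apply hx; exists (exist _ S h1); auto.
      * assert (E : exists S, Ch S /\ forall S' x, In S' l -> proj1_sig S' x -> S x).
        { clear Hl HN. induction l as [|[S hS] l (S1 & k1 & k2)].
          - exists S0; simpl; tauto.
          - destruct (Htot S S1 hS k1) as [h|h].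
            + exists S1; split; auto. intros S' x [<-|h'] hx; [apply h|]; eauto.
            + exists S; split; auto. intros S' x [<-|h'] hx; [|apply h]; eauto. }
        destruct E as (S & k1 & k2). destruct (HCh S k1) as (_ & _ & [x hx]).
        destruct (Hl x) as (S' & m1 & m2). apply hx; eauto.
  - exists (fun x => ~ O x); split; [|split; [|split]]; auto.
    + replace (fun x => ~ ~ O x) with O; auto. apply pred_ext; intros x; tauto.
    + intros D k1 k2 k3 [x hx] y hy. apply NNPP; intros hD. apply hy.
      apply (Hmax (fun z => ~ D z)); auto.
      * split; [|split]; auto; exists x; tauto.
      * intros z hz hDz; apply (k3 z); auto.
Qed.

(** * The greatest ambit *)

Section Ambit.
Variables (L : language) (F : structure L).
Implicit Types g h v : Aut F.
Implicit Types P Q : Aut F -> Prop.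

Lemma aut_mulA g h v : aut_mul g (aut_mul h v) = aut_mul (aut_mul g h) v.
Proof. apply aut_ext; reflexivity. Qed.

Lemma aut_mul1 g : aut_mul aut_one g = g.
Proof. apply aut_ext; reflexivity. Qed.

Lemma aut_mulKV g h : aut_mul (aut_inv g) (aut_mul g h) = h.
Proof. apply aut_ext; intros x; exact (aut_Kinv g (h x)). Qed.

Lemma aut_mulVK g h : aut_mul g (aut_mul (aut_inv g) h) = h.
Proof. apply aut_ext; intros x; exact (aut_invK g (h x)). Qed.

Lemma aut_inv_mul g h x : aut_inv (aut_mul g h) x = aut_inv h (aut_inv g x).
Proof.
  apply (proj1 (aut_embedding (aut_mul g h))). rewrite aut_invK.
  change (x = g (h (aut_inv h (aut_inv g x)))). rewrite !aut_invK; auto.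
Qed.

Lemma fixes_inv s v : fixes s v -> fixes s (aut_inv v).
Proof. intros H y hy. rewrite <- (H y hy) at 1. apply aut_Kinv. Qed.

Lemma fixes_mul s v h : fixes s v -> fixes s h -> fixes s (aut_mul v h).
Proof. intros H1 H2 y hy. change (v (h y) = y). rewrite H2; auto. Qed.

(** Equivalently, [P] is a union of cosets [G_s g]. *)
Definition left_invariant (s : list F) P : Prop :=
  forall v g, fixes s v -> P g -> P (aut_mul v g).

Definition uniform_set P : Prop := exists s, left_invariant s P.

Lemma uniform_compl P : uniform_set P -> uniform_set (fun g => ~ P g).
Proof.
  intros [s Hs]; exists s; intros v g hv hg h. apply hg.
  rewrite <- (aut_mulKV v g). apply Hs; auto using fixes_inv.
Qed.

(** If [P] is invariant under [G_s], its translate is invariant under [g^{-1} G_s g], the stabilizer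
    of [g^{-1} s]. *)
Lemma uniform_translate g P : uniform_set P -> uniform_set (fun h => P (aut_mul g h)).
Proof.
  intros [s Hs]. exists (map (aut_inv g) s). intros v h hv hP.
  replace (aut_mul g (aut_mul v h))
    with (aut_mul (aut_mul g (aut_mul v (aut_inv g))) (aut_mul g h)).
  - apply Hs; auto. intros y hy. change (g (v (aut_inv g y)) = y).
    rewrite hv; [apply aut_invK|apply in_map, hy].
  - rewrite <- !aut_mulA, aut_mulKV; auto.
Qed.

(* Points are the traces of ultrafilters on the algebra of uniform sets, that is, the
   ultrafilters of this algebra; [ambit] is the Samuel compactification of the group. *)
Definition ambit := {p : (Aut F -> Prop) -> Prop |
  exists U, ultrafilter U /\ forall P, p P <-> uniform_set P /\ U P}.

Definition amb_in (p : ambit) P : Prop := proj1_sig p P.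

Lemma amb_uniform p P : amb_in p P -> uniform_set P.
Proof. destruct p as [p (U & HU & Hp)]; simpl; intros h; apply Hp, h. Qed.

Lemma amb_em p P : uniform_set P -> amb_in p P \/ amb_in p (fun g => ~ P g).
Proof.
  destruct p as [p (U & HU & Hp)]; unfold amb_in; simpl; intros h. rewrite !Hp.
  destruct (uf_em HU P); [left|right]; auto using uniform_compl.
Qed.

Lemma amb_fip p l : (forall P, In P l -> amb_in p P) -> exists g, forall P, In P l -> P g.
Proof.
  destruct p as [p (U & HU & Hp)]; unfold amb_in; simpl; intros h.
  apply (uf_inh HU), (uf_list (fun P => P)); auto. intros P hP; apply Hp; auto.
Qed.

Lemma amb_not p P : amb_in p P -> ~ amb_in p (fun g => ~ P g).
Proof.
  intros h1 h2. destruct (amb_fip p [P; fun g => ~ P g]) as [g hg].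
  - intros Q [<-|[<-|[]]]; auto.
  - apply (hg (fun g => ~ P g)); [|apply hg]; simpl; auto.
Qed.

Lemma amb_inter p P Q : amb_in p P -> amb_in p Q -> amb_in p (fun g => P g /\ Q g).
Proof.
  destruct p as [p (U & HU & Hp)]; unfold amb_in; simpl. rewrite !Hp.
  intros [[s hs] hP] [[t ht] hQ]. split; [|apply uf_inter; auto].
  exists (s ++ t); intros v g hv [k1 k2].
  split; [apply hs|apply ht]; auto; intros y hy; apply hv, in_or_app; auto.
Qed.

Lemma amb_full p : amb_in p (fun _ => True).
Proof.
  destruct (amb_em p (P := fun _ => True)) as [h|h]; auto.
  - exists []; intros v g; auto.
  - destruct (amb_fip p [fun _ => ~ True]) as [g hg].
    + intros P [<-|[]]; auto.
    + destruct (hg (fun _ => ~ True)); simpl; auto.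
Qed.

Lemma amb_ext (p q : ambit) : (forall P, amb_in p P <-> amb_in q P) -> p = q.
Proof. intros H; apply sig_ext, pred_ext, H. Qed.

(** The Stone topology, with the sets of all [p] containing a given [P] as base. *)
Definition amb_open (O : ambit -> Prop) : Prop :=
  forall p, O p -> exists P, amb_in p P /\ forall q, amb_in q P -> O q.

Lemma amb_open_full : amb_open (fun _ => True).
Proof. intros p _; exists (fun _ => True); split; auto using amb_full. Qed.

Lemma amb_open_inter O O' : amb_open O -> amb_open O' -> amb_open (fun x => O x /\ O' x).
Proof.
  intros HO HO' p [h h'].
  destruct (HO p h) as (P & h1 & h2), (HO' p h') as (Q & k1 & k2).
  exists (fun g => P g /\ Q g); split; [apply amb_inter; auto|].
  (* A point of the ambit contains uniform sets only, so upward closure requires the larger set [R]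
     to be uniform. *)
  assert (M : forall q R, (forall g, P g /\ Q g -> R g) -> uniform_set R ->
      amb_in q (fun g => P g /\ Q g) -> amb_in q R).
  { intros q R HR HuR hq. destruct (amb_em q HuR) as [|hN]; auto.
    destruct (amb_fip q [fun g => P g /\ Q g; fun g => ~ R g]) as [g hg].
    - intros S [<-|[<-|[]]]; auto.
    - destruct (hg (fun g => ~ R g)); simpl; auto.
      apply HR, (hg (fun g => P g /\ Q g)); simpl; auto. }
  intros q hq; split; [apply h2|apply k2]; apply M; try tauto; eauto using amb_uniform.
Qed.

Lemma amb_open_union (I : Type) (O : I -> ambit -> Prop) :
  (forall i, amb_open (O i)) -> amb_open (fun x => exists i, O i x).
Proof.
  intros HO p [i hi]. destruct (HO i p hi) as (P & h1 & h2). exists P; eauto.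
Qed.

Definition amb_top : topology ambit :=
  Build_topology amb_open amb_open_full amb_open_inter amb_open_union.

Lemma amb_basic_open P : is_open amb_top (fun p => amb_in p P).
Proof. intros p hp; eauto. Qed.

(** Without a finite subcover, the complements of the uniform sets whose basic open set lies in some
    [O i] have the finite intersection property. The trace of an ultrafilter containing them would
    lie in no [O i]. *)
Lemma amb_compact : compact amb_top.
Proof.
  intros I O HO Hcov. apply NNPP; intros HN.
  set (B := fun R : Aut F -> Prop => exists P i, uniform_set P /\
    (forall q, amb_in q P -> O i q) /\ R = (fun g => ~ P g)).
  destruct (@ultrafilter_extension (Aut F) B) as (U & HU & hB).
  - intros l Hl. apply NNPP; intros Hno.
    assert (E : exists li : list I, forall R, In R l -> exists P i, In i li /\ uniform_set P /\
        (forall q, amb_in q P -> O i q) /\ R = (fun g => ~ P g)).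
    { clear Hno. induction l as [|R l IH]; [exists []; simpl; tauto|].
      destruct IH as [li Hli]; [intros; apply Hl; simpl; auto|].
      destruct (Hl R (or_introl eq_refl)) as (P & i & h1 & h2 & h3).
      exists (i :: li); intros R' [<-|hR'].
      - exists P, i; simpl; auto.
      - destruct (Hli R' hR') as (P' & i' & k1 & k2). exists P', i'; simpl; auto. }
    destruct E as [li Hli]. apply HN; exists li. intros q.
    apply NNPP; intros hq. destruct (amb_fip q l) as [g hg]; [|apply Hno; eauto].
    intros R hR. destruct (Hli R hR) as (P & i & h1 & h2 & h3 & ->).
    destruct (amb_em q h2); auto. destruct hq; eauto.
  - assert (Hp : exists U', ultrafilter U' /\
        forall P, (uniform_set P /\ U P) <-> uniform_set P /\ U' P) by (exists U; split; tauto).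
    set (p := exist _ _ Hp : ambit).
    destruct (Hcov p) as [i hi]. destruct (HO i p hi) as (P & [h1 h1'] & h2).
    apply (uf_not P HU); auto. apply hB. exists P, i; auto.
Qed.

Lemma amb_hausdorff : hausdorff amb_top.
Proof.
  intros p q hpq.
  assert (E : exists P, amb_in p P /\ ~ amb_in q P).
  { apply NNPP; intros HN. apply hpq, amb_ext.
    assert (H : forall P, amb_in p P -> amb_in q P).
    { intros P h; apply NNPP; intros h'; apply HN; eauto. }
    intros P; split; auto. intros hq.
    destruct (amb_em p (amb_uniform q P hq)) as [|hp]; auto.
    destruct (amb_not q P hq); auto. }
  destruct E as (P & h1 & h2).
  exists (fun r => amb_in r P), (fun r => amb_in r (fun g => ~ P g)).
  repeat split; auto using amb_basic_open.
  - destruct (amb_em q (amb_uniform p P h1)); tauto.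
  - intros r [k1 k2]; apply (amb_not r P); auto.
Qed.

(** The translate is the pushforward of the ultrafilter along left multiplication by [g]; uniformity
    of [P] is recovered by translating back with [g^{-1}]. *)
Lemma amb_translate_subproof g (p : ambit) :
  exists U, ultrafilter U /\
    forall P, amb_in p (fun h => P (aut_mul g h)) <-> uniform_set P /\ U P.
Proof.
  destruct p as [p (U & HU & Hp)]. exists (fun P => U (fun h => P (aut_mul g h))); split.
  - split.
    + intros P Q h1 h2; exact (uf_inter HU h1 h2).
    + intros P Q h1 h2; apply (uf_up HU h1); auto.
    + intros P h; destruct (uf_inh HU h); eauto.
    + intros P; apply (uf_em HU).
  - intros P; unfold amb_in; simpl; rewrite Hp. split; intros [h1 h2]; split; auto.
    + apply (uniform_translate (aut_inv g)) in h1.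
      replace P with (fun h => P (aut_mul g (aut_mul (aut_inv g) h))); auto.
      apply functional_extensionality; intros h; rewrite aut_mulVK; auto.
    + apply uniform_translate; auto.
Qed.

Definition amb_translate g p : ambit := exist _ _ (amb_translate_subproof g p).

Definition amb_act (g : F -> F) (p : ambit) : ambit :=
  match excluded_middle_informative (automorphism F g) with
  | left H => amb_translate (exist _ g H) p
  | right _ => p
  end.

Lemma amb_actE g p : amb_act g p = amb_translate g p.
Proof.
  unfold amb_act. destruct excluded_middle_informative as [H|H].
  - f_equal; apply sig_ext; reflexivity.
  - destruct H; exact (proj2_sig g).
Qed.

Lemma amb_act_id p : amb_act (fun y => y) p = p.
Proof.
  rewrite (amb_actE aut_one). apply amb_ext; intros P; unfold amb_in; simpl.
  replace (fun h => P (aut_mul aut_one h)) with P; [tauto|].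
  apply functional_extensionality; intros h; rewrite aut_mul1; auto.
Qed.

Lemma amb_act_comp (g h : F -> F) : automorphism F g -> automorphism F h ->
  forall p, amb_act (fun y => g (h y)) p = amb_act g (amb_act h p).
Proof.
  intros Hg Hh p. set (g' := exist _ g Hg : Aut F). set (h' := exist _ h Hh : Aut F).
  change (amb_act (aut_mul g' h') p = amb_act g' (amb_act h' p)). rewrite !amb_actE.
  apply amb_ext; intros P; unfold amb_in; simpl; unfold amb_in.
  replace (fun k => P (aut_mul (aut_mul g' h') k)) with (fun k => P (aut_mul g' (aut_mul h' k)));
    [tauto|].
  apply functional_extensionality; intros k; rewrite aut_mulA; auto.
Qed.

Lemma amb_act_cont (g : F -> F) p (W : ambit -> Prop) : automorphism F g ->
  is_open amb_top W -> W (amb_act g p) ->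
  exists (s : list F) (V : ambit -> Prop), is_open amb_top V /\ V p /\
    forall (h : F -> F) z, automorphism F h -> (forall y, In y s -> h y = g y) ->
      V z -> W (amb_act h z).
Proof.
  intros Hg HW hp. set (g' := exist _ g Hg : Aut F).
  change (W (amb_act g' p)) in hp. rewrite amb_actE in hp.
  destruct (HW _ hp) as (P & h1 & h2).
  destruct (amb_uniform _ _ h1) as [s Hs].
  (* Agreement of [h] with [g] on [g^{-1} s] means that [h g^{-1}] fixes [s], the set for which [P]
     is left invariant. *)
  exists (map (aut_inv g') s), (fun q => amb_in q (fun k => P (aut_mul g' k))).
  split; [apply amb_basic_open|split; [exact h1|]].
  intros h z Hh hs hz. set (h' := exist _ h Hh : Aut F).
  change (W (amb_act h' z)). rewrite amb_actE. apply h2.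
  (* [h = v g] with [v] fixing [s], so [P] is pulled back to the same set by [g] and [h]. *)
  set (v := aut_mul h' (aut_inv g')).
  assert (hv : fixes s v).
  { intros y hy. change (h (aut_inv g' y) = y).
    rewrite hs; [exact (aut_invK g' y)|apply in_map, hy]. }
  assert (hvg : forall k, aut_mul h' k = aut_mul v (aut_mul g' k)).
  { intros k; unfold v. rewrite <- aut_mulA, aut_mulKV; auto. }
  change (amb_in z (fun k => P (aut_mul h' k))).
  replace (fun k => P (aut_mul h' k)) with (fun k => P (aut_mul g' k)); auto.
  apply pred_ext; intros k; rewrite hvg; split; intros hk.
  - apply Hs; auto.
  - rewrite <- (aut_mulKV v (aut_mul g' k)). apply Hs; auto using fixes_inv.
Qed.

Definition amb_flow : Gflow F ambit :=
  Build_Gflow amb_compact amb_hausdorff amb_act amb_act_id amb_act_comp amb_act_cont.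

Lemma amb_gact_in g p P : amb_in (gact amb_flow g p) P <-> amb_in p (fun h => P (aut_mul g h)).
Proof. unfold gact; simpl; rewrite amb_actE; reflexivity. Qed.

Lemma amb_inhabited : exists p : ambit, True.
Proof.
  assert (Hp : exists U, ultrafilter U /\
      forall P, (uniform_set P /\ P aut_one) <-> uniform_set P /\ U P).
  { exists (fun P => P aut_one); split; [|tauto]. split; eauto. intros P; apply classic. }
  exists (exist _ (fun P => uniform_set P /\ P aut_one) Hp); auto.
Qed.

(** * Extension of the orbit map of a point [y0] from the group to the ambit *)

Section OrbitMap.
Variables (Y : Type) (fY : Gflow F Y) (y0 : Y).

(** [y] is a cluster point of [g y0] along [p]; it turns out to be unique. *)
Definition orbit_limit (p : ambit) (y : Y) : Prop :=
  forall W P, is_open (ftop fY) W -> W y -> amb_in p P -> exists g, P g /\ W (gact fY g y0).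

(** Otherwise finitely many open sets cover [Y], each avoided by [g y0] for all [g] in some member
    of [p]; an element [g] common to these members leaves no place for [g y0]. *)
Lemma orbit_limit_exists p : exists y, orbit_limit p y.
Proof.
  apply NNPP; intros HN.
  set (PJ := fun j : (Y -> Prop) * (Aut F -> Prop) => is_open (ftop fY) (fst j) /\
    amb_in p (snd j) /\ forall g, snd j g -> ~ fst j (gact fY g y0)).
  destruct (fcompact fY (fun j : sig PJ => fst (proj1_sig j))) as [l Hl].
  - intros j; apply (proj2_sig j).
  - intros y. apply NNPP; intros hy. apply HN; exists y. intros W P h1 h2 h3.
    apply NNPP; intros h4. apply hy.
    assert (h : PJ (W, P)) by (repeat split; auto; intros g k1 k2; apply h4; eauto).
    exists (exist _ _ h); auto.
  - destruct (amb_fip p (map (fun j : sig PJ => snd (proj1_sig j)) l)) as [g hg].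
    + intros P hP; apply in_map_iff in hP; destruct hP as (j & <- & _); apply (proj2_sig j).
    + destruct (Hl (gact fY g y0)) as (j & h1 & h2).
      apply (proj2 (proj2 (proj2_sig j)) g); auto.
      apply hg, in_map_iff; eauto.
Qed.

(** This gives both uniqueness and continuity. The set [S] of those [g] for which the [G_s]-orbit of
    [g y0] meets [P] is uniform and belongs to [p]; if it belongs to [q], uniform separation keeps
    every cluster point along [q] out of [Q], hence in [W]. *)
Lemma orbit_limit_nbhd p y (W : Y -> Prop) :
  orbit_limit p y -> is_open (ftop fY) W -> W y ->
  exists P, amb_in p P /\ forall q z, amb_in q P -> orbit_limit q z -> W z.
Proof.
  intros Hy HW hy.
  destruct (flow_unif_regular fY y W HW hy) as (s & P & Q & h1 & h2 & h3 & h4 & h5).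
  set (S := fun g => meets fY s (gact fY g y0) P).
  assert (HS : uniform_set S).
  { exists s; intros v g hv (w & k1 & k2). exists (aut_mul w (aut_inv v)); split.
    - apply fixes_mul; auto using fixes_inv.
    - rewrite <- gact_mul, <- aut_mulA, aut_mulKV, gact_mul; auto. }
  assert (f1 : fixes s aut_one) by (intros x _; auto).
  exists S; split.
  - destruct (amb_em p HS) as [h|h]; auto.
    destruct (Hy P _ h1 h3 h) as (g & k1 & k2).
    destruct k1. exists aut_one; split; auto. rewrite gact_one; auto.
  - intros q z hq Hz. destruct (h4 z) as [|hz]; auto.
    destruct (Hz Q S h2 hz hq) as (g & (v & k1 & k2) & k3).
    destruct (h5 (gact fY g y0) v aut_one); auto. rewrite gact_one; auto.
Qed.

Lemma orbit_limit_unique p y z : orbit_limit p y -> orbit_limit p z -> y = z.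
Proof.
  intros Hy Hz. apply NNPP; intros hyz.
  destruct (fhausdorff fY hyz) as (U & V & h1 & h2 & h3 & h4 & h5).
  destruct (orbit_limit_nbhd _ Hy h1 h3) as (P & k1 & k2).
  apply (h5 z); split; eauto.
Qed.

Lemma orbit_limit_equivariant g p y :
  orbit_limit p y -> orbit_limit (gact amb_flow g p) (gact fY g y).
Proof.
  intros Hy W P HW hW hP. apply amb_gact_in in hP.
  destruct (Hy (fun z => W (gact fY g z)) _ (gact_preimage_open fY g W HW) hW hP)
    as (h & h1 & h2).
  exists (aut_mul g h); split; auto. rewrite gact_mul; auto.
Qed.

Definition orbit_map (p : ambit) : Y :=
  proj1_sig (constructive_indefinite_description _ (orbit_limit_exists p)).

Lemma orbit_map_limit p : orbit_limit p (orbit_map p).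
Proof. unfold orbit_map; apply proj2_sig. Qed.

Lemma orbit_map_hom : flow_hom amb_flow fY orbit_map.
Proof.
  split.
  - intros W HW p hp. destruct (orbit_limit_nbhd W (orbit_map_limit p) HW hp) as (P & h1 & h2).
    exists P; split; auto. intros q hq. eapply h2; eauto using orbit_map_limit.
  - intros g p Hg. apply (@orbit_limit_unique (act amb_flow g p)).
    + apply orbit_map_limit.
    + exact (orbit_limit_equivariant (exist _ g Hg) (orbit_map_limit p)).
Qed.

End OrbitMap.

(** The orbit map restricted to a minimal subset of the ambit has a closed, invariant, nonempty
    image, which is all of a minimal [Y]. *)
Lemma universal_minimal_flow_exists :
  exists (C : ambit -> Prop) (HC : is_open (ftop amb_flow) (fun x => ~ C x))
    (Hinv : forall g x, C x -> C (gact amb_flow g x)),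
    (exists p, C p) /\ universal_minimal_flow (subflow amb_flow C HC Hinv).
Proof.
  destruct (minimal_subset_exists amb_flow amb_inhabited) as (C & HC & Hinv & Hne & Hmin).
  exists C, HC, Hinv; split; auto. split; [apply subflow_minimal; auto|].
  intros Y fY HY. pose proof HY as [[y0 _] HYmin].
  destruct (orbit_map_hom fY y0) as [h1 h2].
  set (phi := fun x : sig C => orbit_map fY y0 (proj1_sig x)).
  assert (Hphi : flow_hom (subflow amb_flow C HC Hinv) fY phi).
  { split.
    - intros W HW x hx. exists (fun p => W (orbit_map fY y0 p)); split; [exact (h1 W HW)|auto].
    - intros g x Hg. unfold phi; simpl. rewrite sub_actE; auto. }
  exists phi; split; auto.
  destruct (HYmin (fun y => exists x, phi x = y)) as [h|h]; auto.
  - apply (compact_image_closed phi (fcompact (subflow amb_flow C HC Hinv)) (fhausdorff fY)). apply Hphi.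
  - intros g y Hg [x <-]. exists (act (subflow amb_flow C HC Hinv) g x). apply Hphi, Hg.
  - destruct Hne as [p hp]. destruct (h (phi (exist _ p hp))); eauto.
Qed.

End Ambit.

(** * A small universal minimal flow bounds the Ramsey degree *)

Lemma small_subflow_arrow (L : language) (K : structure L -> Prop) (F : structure L)
    (C : ambit F -> Prop) (A B : structure L) (k d : nat) :
  is_fraisse_limit K F -> (forall A, K A -> finite_struct A) -> K A -> K B ->
  (forall g x, C x -> C (gact (amb_flow F) g x)) -> (exists p, C p) ->
  at_most_points (sig C) d -> ramsey_arrow A B F k d.
Proof.
  intros HF Kfin HA HB Hinv [p hp] [lC [hlC hC]] chi Hchi.
  destruct HF as (_ & _ & Hhom & HK).
  destruct (proj2 (HK A) HA) as [Afg [a0 Ha0]].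
  destruct (proj2 (HK B) HB) as [_ [eB HeB]].
  destruct (Kfin A HA) as [lA hlA], (Kfin B HB) as [lB hlB].
  destruct (finite_function_space lA lB hlA hlB) as [fs hfs].
  (* [h] stands for the embedding [h^{-1} a0]; the inverse makes [colour] invariant under left
     multiplication by the stabilizer of the image of [a0]. *)
  set (colour := fun (h : Aut F) => chi (fun x => aut_inv h (a0 x))).
  assert (Hunif : forall i, uniform_set (fun h => colour h = i)).
  { intros i; exists (map a0 lA). intros v g hv <-. unfold colour. f_equal.
    apply functional_extensionality; intros x. rewrite aut_inv_mul. f_equal.
    apply (fixes_inv hv), in_map, hlA. }
  assert (Hval : forall q : ambit F, exists i, amb_in q (fun h => colour h = i)).
  { intros [q (U & HU & Hq)]. destruct (uf_bounded_value colour k HU) as (i & _ & hi).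
    - destruct (uf_em HU (fun x => colour x < k)) as [|h]; auto.
      destruct (uf_inh HU h) as [g hg]. destruct hg. apply Hchi.
      apply (embedding_comp Ha0 (aut_embedding (aut_inv g))).
    - exists i. apply Hq; auto. }
  set (val := fun q => proj1_sig (constructive_indefinite_description _ (Hval q))).
  assert (Hval' : forall q, amb_in q (fun h => colour h = val q)).
  { intros q; unfold val; destruct constructive_indefinite_description; auto. }
  (* One colour for each point of [C], hence at most [d] colours. *)
  set (l := map (fun q : sig C => val (proj1_sig q)) lC).
  destruct (proj2_sig p) as (U & HU & Hp).
  assert (Hall : U (fun h => forall a, In a fs -> embedding A B a ->
      In (chi (fun x => aut_inv h (eB (a x)))) l)).
  { apply (uf_list (fun a h => embedding A B a -> In (chi (fun x => aut_inv h (eB (a x)))) l));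
      auto.
    intros a _. destruct (classic (embedding A B a)) as [Ha|Ha].
    2:{ destruct (uf_em HU (fun _ => True)) as [h|h]; [|destruct (uf_inh HU h); tauto].
        apply (uf_up HU h); tauto. }
    (* Homogeneity gives [g] with [g eB a = a0]. Then [h^{-1} eB a] is [(g h)^{-1} a0], whose colour
       is the value at the translate [g p] for [U]-almost all [h]. *)
    destruct (Hhom A (fun x => eB (a x)) a0 Afg (embedding_comp Ha HeB) Ha0) as (g0 & Hg0 & Hg).
    set (g := exist _ g0 Hg0 : Aut F).
    set (q := gact (amb_flow F) g p).
    pose proof (Hval' q) as hq. apply amb_gact_in, Hp in hq.
    apply (uf_up HU (proj2 hq)). intros h hh _.
    replace (fun x => aut_inv h (eB (a x))) with (fun x => aut_inv (aut_mul g h) (a0 x)).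
    - change (In (colour (aut_mul g h)) l). rewrite hh.
      apply in_map_iff. exists (exist _ q (Hinv g p hp)); auto.
    - apply functional_extensionality; intros x. rewrite aut_inv_mul, <- Hg.
      f_equal; apply (aut_Kinv g). }
  destruct (uf_inh HU Hall) as [h hh].
  exists (fun y => aut_inv h (eB y)); split.
  - apply (embedding_comp HeB (aut_embedding (aut_inv h))).
  - exists l; split; [unfold l; rewrite length_map; auto|]. intros a Ha; apply hh; auto.
Qed.

(* An ultrafilter limit of bad colourings of the finite substructures of [F] is a bad
   colouring of [F]. *)
Lemma ramsey_arrow_limit (L : language) (K : structure L -> Prop) (F : structure L)
    (A B : structure L) (k d : nat) :
  is_fraisse_limit K F -> (forall A, K A -> finite_struct A) -> K A -> K B -> 0 < k ->
  ramsey_arrow A B F k d -> exists C, K C /\ ramsey_arrow A B C k d.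
Proof.
  intros HF Kfin HA HB Hk Harr. apply NNPP; intros HN.
  destruct (Kfin A HA) as [lA hlA], (Kfin B HB) as [lB hlB].
  destruct (finite_function_space lA lB hlA hlB) as [fs hfs].
  assert (Hbad : forall t : list F, exists psi : (A -> F) -> nat,
      (forall e, embedding A F e -> psi e < k) /\
      forall b : B -> F, embedding B F b -> (forall y, generated F t (b y)) ->
        forall l, length l <= d ->
        ~ forall a, embedding A B a -> In (psi (fun x => b (a x))) l).
  { intros t.
    assert (H : ~ ramsey_arrow A B (gen_sub F t) k d).
    { intros h; apply HN; exists (gen_sub F t); split; auto. apply gen_sub_in_class; auto. }
    apply not_all_ex_not in H; destruct H as [chi H].
    apply imply_to_and in H; destruct H as [Hchi Hno].
    (* Embeddings leaving the substructure get the default colour [0], which is admissible because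
       [0 < k]. *)
    exists (fun e => match excluded_middle_informative (forall x, generated F t (e x)) with
      | left H => chi (fun x => exist _ (e x) (H x)) | right _ => 0 end); split.
    - intros e He. destruct excluded_middle_informative as [H|H]; auto.
      apply Hchi, embedding_gen_sub, He.
    - intros b Hb Hbt l Hl Hin. apply Hno.
      exists (fun y => exist _ (b y) (Hbt y)); split; [apply embedding_gen_sub, Hb|].
      exists l; split; auto. intros a Ha. specialize (Hin a Ha).
      destruct excluded_middle_informative as [H|H].
      + replace (fun x => exist _ (b (a x)) (Hbt (a x)))
          with (fun x => exist (generated F t) (b (a x)) (H x)); auto.
        apply functional_extensionality; intros x; apply sig_ext; auto.
      + destruct H; auto. }
  apply (choice (fun t psi => (forall e, embedding A F e -> psi e < k) /\
      forall b : B -> F, embedding B F b -> (forall y, generated F t (b y)) ->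
        forall l, length l <= d ->
        ~ forall a, embedding A B a -> In (psi (fun x => b (a x))) l)) in Hbad.
  destruct Hbad as [psi Hpsi].
  (* The ultrafilter contains every cone of the lists [t] that include a given [s], so almost every
     [t] contains any prescribed finite part of [F]. *)
  destruct (@ultrafilter_extension (list F) (fun P => exists s, P = fun t => incl s t))
    as (U & HU & HB').
  { intros l Hl.
    assert (E : exists s, forall P, In P l -> exists s', P = (fun t => incl s' t) /\ incl s' s).
    { induction l as [|P l IH]; [exists []; simpl; tauto|].
      destruct IH as [s Hs]; [intros; apply Hl; simpl; auto|].
      destruct (Hl P (or_introl eq_refl)) as [s' ->].
      exists (s' ++ s); intros Q [<-|hQ].
      - exists s'; split; auto. apply incl_appl, incl_refl.
      - destruct (Hs Q hQ) as (s'' & -> & h). exists s''; split; auto. apply incl_appr, h. }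
    destruct E as [s Hs]. exists s; intros P hP. destruct (Hs P hP) as (s' & -> & h); auto. }
  assert (Hlim : forall e, exists i, embedding A F e -> i < k /\ U (fun t => psi t e = i)).
  { intros e. destruct (classic (embedding A F e)) as [He|He]; [|exists 0; tauto].
    destruct (@uf_bounded_value _ U (fun t => psi t e) k HU) as (i & h1 & h2); eauto.
    apply (uf_up HU (HB' _ (ex_intro _ [] eq_refl))). intros t _; apply Hpsi, He. }
  apply choice in Hlim; destruct Hlim as [chi Hchi].
  destruct (Harr chi) as (b & Hb & l & Hl & Hin); [intros e He; apply Hchi, He|].
  assert (Hall : U (fun t => forall a, In a fs -> embedding A B a ->
      psi t (fun x => b (a x)) = chi (fun x => b (a x)))).
  { apply (uf_list (fun a t => embedding A B a ->
      psi t (fun x => b (a x)) = chi (fun x => b (a x)))); auto.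
    intros a _. destruct (classic (embedding A B a)) as [Ha|Ha].
    - apply (uf_up HU (proj2 (Hchi _ (embedding_comp Ha Hb)))); auto.
    - apply (uf_up HU (HB' _ (ex_intro _ [] eq_refl))); tauto. }
  (* Some [t] contains the image of [b] while its bad colouring agrees with the limit [chi] on every
     [b o a]; this contradicts the choice of [psi t]. *)
  pose proof (HB' _ (ex_intro _ (map b lB) eq_refl)) as Hcone.
  destruct (uf_inh HU (uf_inter HU Hall Hcone)) as (t & h1 & h2).
  apply (proj2 (Hpsi t) b Hb) with (l := l); auto.
  - intros y; apply generated_in, h2, in_map, hlB.
  - intros a Ha. rewrite h1; auto.
Qed.

Theorem mainTheorem1 (L : language) (d : nat) (K : structure L -> Prop)
  (HK : fraisse_class K) (F : structure L) (HF : is_fraisse_limit K F) :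
  UMF_at_most F d <-> class_ramsey_degree_le K d.
Proof.
  destruct HK as [Kfin _]. split.
  - intros Humf A HA. exists d; split; auto. intros B HB k Hk.
    destruct (universal_minimal_flow_exists F) as (C & HC & Hinv & Hne & HC').
    (* The flow yields the arrow with [F] itself as target; compactness then replaces [F] by a
       member of [K]. *)
    apply ramsey_arrow_limit with (F := F); auto; [lia|].
    apply small_subflow_arrow with (K := K) (C := C); auto. apply (Humf _ _ HC').
  - intros HR X fX [Hmin _]. apply (minimal_flow_bounded HF HR Hmin).
Qed.
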